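(* The regularized DTH equations are coordinate invariant under linear, symplectic coordinate transformations. That is, let $z=TZ$ be a linear symplectic coordinate transformation of extended phase space, let $\mathcal H(z)$ be a Hamiltonian function in the old coordinates and $\mathcal K(Z)=\mathcal H(TZ)$ the Hamiltonian function in the new coordinates, and let $z_k=TZ_k$ for $k=0,\dots,N$. Then the vertices $z_0,\dots,z_N$ satisfy, with multipliers $\lambda_k,\mu_k$ and constants $\psi_k$, the regularized DTH equations for $\mathcal H$ if and only if $Z_0,\dots,Z_N$ satisfy, with the same multipliers $\lambda_k,\mu_k$ and constants $\psi_k$, the regularized DTH equations for $\mathcal K$.
   Context: Extended phase space is $\mathbb R^{2(n+1)}$ with points $z=(q,p)$, $q,p\in\mathbb R^{n+1}$. $J=\begin{pmatrix}0&I\\-I&0\end{pmatrix}$ with $I$ the $(n+1)\times(n+1)$ identity. A matrix $T$ is symplectic if $T^\top JT=J$ (equivalently $TJT^\top=J$). For a sufficiently smooth ($C^3$) function $\mathcal F$ on an open subset of extended phase space, with gradient $\mathcal F_z$ and Hessian $\mathcal F_{zz}$, put $\psi^{\mathcal F}=(J\mathcal F_z)^\top\mathcal F_{zz}(J\mathcal F_z)$. The regularized DTH equations for $\mathcal F$, for vertices $w_0,\dots,w_N$, multipliers $\lambda_k,\mu_k$ and real constants $\psi_k$, are, with $\Delta w_k=w_{k+1}-w_k$, $\overline w_k=\tfrac12(w_{k+1}+w_k)$ and $k=0,\dots,N-1$: \[\Delta w_k=\lambda_kJ\mathcal F_z(\overline w_k)+\mu_kJ\psi^{\mathcal F}_z(\overline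 w_k),\quad \mathcal F(\overline w_k)=0,\quad \psi^{\mathcal F}(\overline w_k)\ge\psi_k\ (\text{or }\le\psi_k),\] \[\mu_k(\psi^{\mathcal F}(\overline w_k)-\psi_k)=0,\quad \mu_k\le0\ (\text{or }\mu_k\ge0),\] where for each $k$ the first alternatives are taken together or the second alternatives are taken together, with the same choice in both coordinate systems. *)

(* Defs.v *)
From mathcomp Require Import all_boot all_order all_algebra.
From mathcomp Require Import all_classical all_reals all_analysis.
Import Order.TTheory GRing.Theory Num.Theory.
Import numFieldNormedType.Exports.

Set Implicit Arguments.
Unset Strict Implicit.
Unset Printing Implicit Defensive.

Local Open Scope classical_set_scope.
Local Open Scope ring_scope.

(* The point z = (q, p), with q and p in R^(n+1), is [col_mx q p]. *)
Notation phase_space R n := 'cV[R]_(n.+1 + n.+1).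

Section calculus.
Context {R : realType} {m : nat}.
Implicit Types (f : 'cV[R]_m -> R) (U : set 'cV[R]_m).

Definition partial (i : 'I_m) f : 'cV[R]_m -> R :=
  fun z => 'D_(delta_mx i 0) f z.

Definition gradient f (z : 'cV[R]_m) : 'cV[R]_m := \col_i partial i f z.

Definition hessian f (z : 'cV[R]_m) : 'M[R]_m :=
  \matrix_(i, j) partial i (partial j f) z.

(* [f] is total; only its restriction to the open set [U] is constrained. *)
Fixpoint Ck (k : nat) U f : Prop :=
  if k is k'.+1 then
    (forall z, U z -> differentiable f z) /\ (forall i, Ck k' U (partial i f))
  else forall z, U z -> {for z, continuous f}.

End calculus.

Section dth.
Context {R : realType} {n : nat}.
Implicit Types (F : phase_space R n -> R) (z : phase_space R n).

Definition symplectic_form : 'M[R]_(n.+1 + n.+1) :=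
  block_mx 0 1%:M (- 1%:M) 0.

Local Notation J := symplectic_form.

Definition symplectic (T : 'M[R]_(n.+1 + n.+1)) : Prop := T^T *m J *m T = J.

Definition psi F z : R :=
  ((J *m gradient F z)^T *m hessian F z *m (J *m gradient F z)) 0 0.

Section vertices.
Context {N : nat} (w : 'I_N.+1 -> phase_space R n).

(* [w_succ k] and [w_cur k] are the vertices w_(k+1) and w_k, for k < N. *)
Local Notation w_succ k := (w (lift ord0 k)).
Local Notation w_cur k := (w (widen_ord (leqnSn N) k)).

Definition increment (k : 'I_N) : phase_space R n := w_succ k - w_cur k.

Definition midpoint (k : 'I_N) : phase_space R n :=
  2^-1 *: (w_succ k + w_cur k).

End vertices.

(* [U] is the domain of [F]: since the equations evaluate [F] and its
   derivatives at the midpoints, these must lie in [U].  At step [k] the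
   inequalities read psi >= psi_k, mu_k <= 0 if [lower k] is true, and
   psi <= psi_k, mu_k >= 0 otherwise. *)
Definition regularized_DTH {N : nat} (lower : 'I_N -> bool)
    (U : set (phase_space R n)) F (w : 'I_N.+1 -> phase_space R n)
    (lambda mu psi_ : 'I_N -> R) : Prop :=
  forall k : 'I_N, let wk := midpoint w k in
  [/\ U wk,
      increment w k = lambda k *: (J *m gradient F wk)
                      + mu k *: (J *m gradient (psi F) wk),
      F wk = 0,
      mu k * (psi F wk - psi_ k) = 0 &
      if lower k then psi_ k <= psi F wk /\ mu k <= 0
                 else psi F wk <= psi_ k /\ 0 <= mu k].

End dth.

(* Main.v *)
(** For any linear T, the chain rule gives gradient (F o T) = T^T gradient F
    and hessian (F o T) = T^T (hessian F) T.  A symplectic T also satisfies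
    T J T^T = J, so T (J gradient (F o T)) = J gradient F: Hamiltonian vector
    fields transform as vectors.  Hence psi (F o T) = psi F o T, and the same
    rule applied to psi F shows that T carries one system to the other. *)

Require Import Defs.
From mathcomp Require Import all_boot all_order all_algebra.
From mathcomp Require Import all_classical all_reals all_analysis.
Import Order.TTheory GRing.Theory Num.Theory.
Import numFieldNormedType.Exports.

Local Open Scope classical_set_scope.
Local Open Scope ring_scope.

Section differentiable_entries.
Context {R : realType} {V : normedModType R}.

Lemma differentiable_fsum (p : nat) (f : 'I_p -> V -> R) (x : V) :
  (forall i, differentiable (f i) x) ->
  differentiable (fun y => \sum_i f i y) x.
Proof.
move=> df; rewrite (_ : (fun y => _) = \sum_i f i).
  exact: differentiable_sum.
by apply/funext => y; rewrite fct_sumE.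
Qed.

Lemma differentiable_mulmx_entry (p q r : nat) (A : V -> 'M[R]_(p, q))
    (B : V -> 'M[R]_(q, r)) (x : V) :
  (forall i j, differentiable (fun y => A y i j) x) ->
  (forall i j, differentiable (fun y => B y i j) x) ->
  forall i j, differentiable (fun y => (A y *m B y) i j) x.
Proof.
move=> dA dB i j.
under eq_fun do rewrite mxE.
by apply: differentiable_fsum => k; apply: differentiableM.
Qed.

End differentiable_entries.

Section linear_change.
Context {R : realType} {m : nat}.
Implicit Types (T : 'M[R]_m) (f g : 'cV[R]_m -> R) (U : set 'cV[R]_m).

Lemma continuous_mulmx T : continuous (mulmx T : 'cV[R]_m -> 'cV[R]_m).
Proof.
move=> x; apply: differentiable_continuous.
rewrite (_ : mulmx T = \sum_k (fun y : 'cV[R]_m => y k 0 *: col k T)).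
  by apply: differentiable_sum => k; apply/differentiableZl/differentiable_coord.
apply/funext => y; rewrite fct_sumE; apply/matrixP => i j.
rewrite mxE summxE; apply: eq_bigr => k _.
by rewrite !mxE ord1 mulrC.
Qed.

(** By linearity of [T], both sides are limits of the same difference quotient. *)
Lemma derive_mulmx T f v x : 'D_v (f \o mulmx T) x = 'D_(T *m v) f (T *m x).
Proof. by rewrite /derive /=; under eq_fun do rewrite mulmxDr -scalemxAr. Qed.

Lemma derive_partial f v x : differentiable f x ->
  'D_v f x = \sum_k v k 0 * partial k f x.
Proof.
move=> df; rewrite deriveE //.
have -> : v = \sum_k v k 0 *: delta_mx k 0.
  rewrite [LHS]matrix_sum_delta; apply: eq_bigr => k _.
  by rewrite big_ord_recl big_ord0 addr0.
rewrite linear_sum; apply: eq_bigr => k _.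
rewrite linearZ /= /partial deriveE //; congr (_ * _).
(* Expanding [v] has also expanded the coefficient [v k 0]; only its [k]-th summand survives. *)
rewrite summxE (bigD1 k) //= !mxE !eqxx mulr1 big1 ?addr0 // => j jk.
by rewrite !mxE eq_sym (negbTE jk) mulr0.
Qed.

Lemma gradient_comp T f x : differentiable f (T *m x) ->
  gradient (f \o mulmx T) x = T^T *m gradient f (T *m x).
Proof.
move=> df; apply/matrixP => i j; rewrite !mxE /partial derive_mulmx.
rewrite derive_partial //; apply: eq_bigr => k _.
by rewrite -colE !mxE.
Qed.

Lemma near_eq_gradient f g x : (\near x, f x = g x) ->
  gradient f x = gradient g x.
Proof.
by move=> fg; apply/matrixP => i j; rewrite !mxE; apply: near_eq_derive.
Qed.

Section pullback.
Context {T : 'M[R]_m} {U : set 'cV[R]_m} {f g : 'cV[R]_m -> R}.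
Hypothesis U_open : open U.
Hypothesis fg : forall x, U (T *m x) -> g x = f (T *m x).

Lemma near_pullback x : U (T *m x) -> \near x, U (T *m x).
Proof. by move=> Ux; apply: continuous_mulmx; apply: open_nbhs_nbhs. Qed.

(** Agreement of [g] with [f \o mulmx T] is assumed only over [U], since derived functions such as
    partials and [psi] are compared only there. The preimage of [U] is open, so the two functions
    agree near [x] and share their gradient. *)
Lemma gradient_pullback x : U (T *m x) -> differentiable f (T *m x) ->
  gradient g x = T^T *m gradient f (T *m x).
Proof.
move=> Ux df; rewrite -gradient_comp //; apply: near_eq_gradient.
by apply: filterS (near_pullback _ Ux) => y /fg.
Qed.

End pullback.

Lemma hessian_pullback T U f g :
  open U -> (forall x, U (T *m x) -> g x = f (T *m x)) -> Ck 2 U f ->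
  forall x, U (T *m x) -> hessian g x = T^T *m hessian f (T *m x) *m T.
Proof.
move=> U_open fg [df ddf] x Ux.
have dpf k : differentiable (partial k f) (T *m x) by apply: (ddf k).1.
apply/matrixP => i j.
(* The [j]-th component of [T^T *m gradient f], read in the old coordinates: [partial j g] is the
   pullback of [h], so the gradient rule applies a second time. *)
pose h y := \sum_k T k j * partial k f y.
have gh y : U (T *m y) -> partial j g y = h (T *m y).
  move=> Uy; have /matrixP/(_ j 0) := gradient_pullback U_open fg _ Uy (df _ Uy).
  by rewrite !mxE => ->; apply: eq_bigr => k _; rewrite !mxE.
have dh : differentiable h (T *m x).
  by apply: differentiable_fsum => k; apply: differentiableZ.
have /matrixP/(_ i 0) := gradient_pullback U_open gh _ Ux dh.
rewrite -mulmxA !mxE => ->; apply: eq_bigr => k _; congr (_ * _).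
rewrite !mxE /partial.
rewrite (_ : h = \sum_l (T l j *: partial l f)); last first.
  by apply/funext => y; rewrite fct_sumE.
rewrite derive_sum; last by move=> l; apply/diff_derivable/differentiableZ.
apply: eq_bigr => l _; rewrite deriveZ; last exact: diff_derivable.
by rewrite !mxE mulrC.
Qed.

End linear_change.

Section symplectic.
Context {R : realType} {n : nat}.
Implicit Types (T : 'M[R]_(n.+1 + n.+1)) (U : set (phase_space R n)).
Implicit Types (F G : phase_space R n -> R).

Local Notation J := (@symplectic_form R n).

Lemma symplectic_form_sqr : J *m J = - 1%:M.
Proof.
rewrite /symplectic_form mulmx_block !mulmx0 !mul0mx !mulmx1 !mul1mx.
by rewrite !add0r !addr0 scalar_mx_block opp_block_mx oppr0.
Qed.

Lemma symplectic_left_inverse {T} : symplectic T ->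
  (- J *m T^T *m J) *m T = 1%:M.
Proof.
by move=> sT; rewrite !mulNmx -!mulmxA (mulmxA T^T) sT symplectic_form_sqr opprK.
Qed.

Lemma symplectic_inj {T} : symplectic T ->
  injective (mulmx T : phase_space R n -> phase_space R n).
Proof.
move=> sT; apply: (can_inj (g := mulmx (- J *m T^T *m J))) => x.
by rewrite mulmxA symplectic_left_inverse // mul1mx.
Qed.

(** The left inverse of the square matrix [T] is also a right inverse; multiplying
    [T *m (- J *m T^T *m J) = 1%:M] by [J] on the right gives the claim. *)
Lemma symplectic_tr {T} : symplectic T -> T *m J *m T^T = J.
Proof.
move=> /symplectic_left_inverse /mulmx1C.
rewrite !mulNmx mulmxN !mulmxA => /(congr1 (mulmx^~ J)) /=.
rewrite mulNmx -(mulmxA (T *m J *m T^T)) symplectic_form_sqr.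
by rewrite mulmxN mulmx1 opprK mul1mx.
Qed.

(** [psi F] is a polynomial in the first and second partials of [F], which are differentiable on [U]
    when [F] is of class C^3. *)
Lemma psi_differentiable U F x : Ck 3 U F -> U x -> differentiable (psi F) x.
Proof.
move=> [_ dF] Ux.
have dg i j : differentiable (fun y => gradient F y i j) x.
  by under eq_fun do rewrite mxE; apply: (dF i).1.
have dH i j : differentiable (fun y => hessian F y i j) x.
  by under eq_fun do rewrite mxE; apply: ((dF j).2 i).1.
have dJg i j : differentiable (fun y => (J *m gradient F y) i j) x.
  apply: differentiable_mulmx_entry => // k l; exact: differentiable_cst.
apply: differentiable_mulmx_entry => //; apply: differentiable_mulmx_entry => //.
by move=> i j; under eq_fun do rewrite mxE.
Qed.

Section pullback.
Context {T : 'M[R]_(n.+1 + n.+1)} {U : set (phase_space R n)}.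
Context {F G : phase_space R n -> R}.
Hypotheses (T_symplectic : symplectic T) (U_open : open U).
Hypothesis FG : forall x, U (T *m x) -> G x = F (T *m x).

(** Used for two pairs: the Hamiltonians themselves, and then their [psi] functions. *)
Lemma hamiltonian_field_pullback x :
  U (T *m x) -> differentiable F (T *m x) ->
  T *m (J *m gradient G x) = J *m gradient F (T *m x).
Proof.
move=> Ux dF; rewrite (gradient_pullback U_open FG) //.
by rewrite !mulmxA symplectic_tr.
Qed.

Lemma psi_pullback x : Ck 2 U F -> U (T *m x) -> psi G x = psi F (T *m x).
Proof.
move=> CF Ux; rewrite /psi (hessian_pullback T U F G) //.
rewrite -(hamiltonian_field_pullback _ Ux (CF.1 _ Ux)).
(* The factors [T^T] and [T] around the Hessian are absorbed by the two copies of the field of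
   [G]. *)
by rewrite (trmx_mul T) !mulmxA.
Qed.

End pullback.
End symplectic.

Lemma Ck_pred (R : realType) (m k : nat) (U : set 'cV[R]_m) f :
  Ck k.+1 U f -> Ck k U f.
Proof.
elim: k f => [|k IHk] f [df pf]; first by move=> x /df/differentiable_continuous.
by split=> // i; apply: IHk.
Qed.

Theorem theorem12 (R : realType) (n N : nat)
    (T : 'M[R]_(n.+1 + n.+1)) (T_symplectic : symplectic T)
    (U : set (phase_space R n)) (U_open : open U)
    (H : phase_space R n -> R) (H_smooth : Ck 3 U H)
    (K : phase_space R n -> R)
    (HK : forall Z : phase_space R n, U (T *m Z) -> K Z = H (T *m Z))
    (z Z : 'I_N.+1 -> phase_space R n)
    (zZ : forall k : 'I_N.+1, z k = T *m Z k)
    (lambda mu psi_ : 'I_N -> R) (lower : 'I_N -> bool) :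
  regularized_DTH lower U H z lambda mu psi_ <->
  regularized_DTH lower (mulmx T @^-1` U) K Z lambda mu psi_.
Proof.
have C2 : Ck 2 U H by exact: Ck_pred.
(* This is the agreement over [U] that lets the field rule be applied to [psi H] and [psi K]. *)
have psiK x : U (T *m x) -> psi K x = psi H (T *m x) by exact: psi_pullback.
have midT k : midpoint z k = T *m midpoint Z k.
  by rewrite /midpoint !zZ -mulmxDr -scalemxAr.
have incT k : increment z k = T *m increment Z k.
  by rewrite /increment !zZ -mulmxBr.
have fieldT k x : U (T *m x) ->
    lambda k *: (symplectic_form *m gradient H (T *m x))
      + mu k *: (symplectic_form *m gradient (psi H) (T *m x))
    = T *m (lambda k *: (symplectic_form *m gradient K x)
      + mu k *: (symplectic_form *m gradient (psi K) x)).
  move=> Ux; have dpsiH := psi_differentiable _ _ _ H_smooth Ux.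
  rewrite mulmxDr -!scalemxAr.
  rewrite (hamiltonian_field_pullback T_symplectic U_open HK _ Ux (C2.1 _ Ux)).
  by rewrite (hamiltonian_field_pullback T_symplectic U_open psiK _ Ux dpsiH).
split=> DTH k; move: (DTH k); cbv zeta; rewrite midT incT;
  move: (midpoint Z k) => x [Ux incH H0 compl ineq].
- split; rewrite ?(psiK _ Ux) ?(HK _ Ux);
    [exact: Ux| |exact: H0|exact: compl|exact: ineq].
  (* The increment equation is known only after multiplication by [T], which injectivity cancels. *)
  by apply: (symplectic_inj T_symplectic); rewrite -fieldT.
- split; rewrite -?(psiK _ Ux) -?(HK _ Ux);
    [exact: Ux| |exact: H0|exact: compl|exact: ineq].
  by rewrite fieldT // -incH.
Qed.
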